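(* Let $k,r,n$ be integers with $n\ge k\ge 5$ and $\lfloor (k-1)/2\rfloor+2\le r<k$, and let $\mathcal{H}=\{K_r\}\cup\mathcal{C}_{\ge k}$. Then $$\mathrm{ex}_{2\text{-conn}}(n,\mathcal{H})=\max\{g_r(n,2,k),\ g_r(n,\lfloor (k-1)/2\rfloor,k)\},$$ where $g_r(n,a,k)=(n-k+a)a+\mathrm{ex}(k-a,K_r)$.
   Context: Graphs are finite and simple. $\mathcal{C}_{\ge k}$ is the set of all cycles of length at least $k$. A graph is $\mathcal{H}$-free if it contains no member of $\mathcal{H}$ as a (not necessarily induced) subgraph. $\mathrm{ex}_{2\text{-conn}}(n,\mathcal{H})$ is the maximum number of edges in a 2-connected $n$-vertex $\mathcal{H}$-free graph. $\mathrm{ex}(m,K_r)$ is the maximum number of edges in an $m$-vertex $K_r$-free graph (so it equals $\binom{m}{2}$ when $r>m$). *)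

(* Defs.v *)
(* MathComp (with the classical sets of MathComp-Analysis). *)
From HB Require Import structures.
From mathcomp Require Import all_boot.
From mathcomp Require Import boolp classical_sets.

Set Implicit Arguments.
Unset Strict Implicit.
Unset Printing Implicit Defensive.

(* A finite simple graph with vertex set {0, ..., n-1}, given by its edge set. *)
Record sgraph (n : nat) := SGraph {
  edges : {set {set 'I_n}};
  edges_card2 : [forall e in edges, #|e| == 2]
}.

HB.instance Definition _ (n : nat) := [isSub for @edges n].
HB.instance Definition _ (n : nat) := [Finite of sgraph n by <:].

(* Irreflexive, because [set x; x] has one element. *)
Definition adj (n : nat) (G : sgraph n) : rel 'I_n :=
  fun x y => [set x; y]%SET \in edges G.

Lemma filter_card2 (n : nat) (P : pred {set 'I_n}) :
  [forall e in [set e : {set 'I_n} | (#|e| == 2) && P e]%SET, #|e| == 2].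
Proof. by apply/forall_inP => e; rewrite inE => /andP[]. Qed.

Definition complete_graph (r : nat) : sgraph r :=
  SGraph (filter_card2 (n := r) predT).

(* The cycle of length l when 3 <= l; ordS is the successor modulo l. *)
Definition cycle_graph (l : nat) : sgraph l :=
  SGraph (filter_card2 (n := l)
    (fun e => [exists i : 'I_l, e == [set i; ordS i]%SET])).

Definition graph := {n : nat & sgraph n}.

Definition K_ (r : nat) : graph := Tagged sgraph (complete_graph r).

Definition C_ (l : nat) : graph := Tagged sgraph (cycle_graph l).

(* Cycles have length at least 3. *)
Definition cycles_ge (k : nat) : set graph :=
  [set C_ l | l in [set l : nat | 3 <= l /\ k <= l]]%classic.

(* F is isomorphic to a (not necessarily induced) subgraph of G. *)
Definition subgraph_of (m n : nat) (F : sgraph m) (G : sgraph n) : Prop :=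
  exists2 f : 'I_m -> 'I_n, injective f & {homo f : x y / adj F x y >-> adj G x y}.

Definition free (H : set graph) (n : nat) (G : sgraph n) : Prop :=
  forall F : graph, H F -> ~ subgraph_of (tagged F) G.

(* Connectedness of the subgraph of G induced by S. *)
Definition connected_on (n : nat) (G : sgraph n) (S : {set 'I_n}) : bool :=
  [forall x in S, forall y in S,
     connect (fun u v => [&& u \in S, v \in S & adj G u v]) x y].

Definition two_connected (n : nat) (G : sgraph n) : bool :=
  (2 < n) && [forall X : {set 'I_n}, (#|X| < 2) ==> connected_on G (~: X)%SET].

(* Every n-vertex graph is isomorphic to one on 'I_n, so both maxima range over
   all n-vertex graphs. A maximum over an empty class is 0. *)
Definition ex (n : nat) (H : set graph) : nat :=
  \max_(G : sgraph n | `[< free H G >]) #|edges G|.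

Definition ex_2conn (n : nat) (H : set graph) : nat :=
  \max_(G : sgraph n | `[< two_connected G /\ free H G >]) #|edges G|.

Definition g (r n a k : nat) : nat :=
  (n - k + a) * a + ex (k - a) [set K_ r]%classic.

(* Main.v *)
Require Import Defs.
From mathcomp Require Import boolp classical_sets.
From mathcomp Require Import all_boot zify.
Set Implicit Arguments.
Unset Strict Implicit.
Unset Printing Implicit Defensive.

(** Write t for the integer part of (k - 1) / 2, so that k is 2t + 1 or 2t + 2.

    Upper bound. Let G be 2-connected, without K_r and without cycles of length
    at least k, and add edges to G for as long as no such cycle appears
    ([saturate]); in the resulting graph G', two non-adjacent vertices are
    joined by a path on at least k vertices. Kopylov's lemma ([long_cycle])
    says that such a path, when its ends have together at least k neighbours on
    it, forces a cycle of length at least k. Let the d-core be the largest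
    vertex set in which every vertex has more than d neighbours inside the set.
    Two vertices of the t-core have more than t neighbours there; if they were
    non-adjacent, a longest path between such a pair would contain all those
    neighbours, at least 2t + 2 >= k of them, and the lemma would give too long a
    cycle. Hence the t-core of G' is empty or a clique, and in the second case the
    same argument, applied between the t-core and the d-core with
    d = k - |t-core|, shows that the two cores coincide and that 2 <= d <= t
    ([dense_joined], [core_structure]).

    Deleting one vertex outside the core at a time costs at most t, respectively
    d, edges. If the t-core is empty, this bounds |E(G)| by
    C(t, 2) + t (n - t), which is at most g_r(n, t, k). Otherwise the core has
    k - d vertices; there G is K_r-free, though G' may not be, and so |E(G)| is at most
    ex(k - d, K_r) + d (n - k + d) = g_r(n, d, k) ([edge_bound]). A K_r-free
    graph on s vertices misses at least s + 1 - r pairs (removing one end of each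
    missing pair leaves a clique), and in the range needed this is sharp, the
    missing pairs being a matching. Consequently g_r(n, d, k) is a quadratic
    function of d with second difference 3, minus a truncated linear function of
    slope at most 1; so it is convex on 2 <= d <= t and largest at an end
    ([convex_max]).

    Lower bound. For a = 2 and a = t, take a vertices adjacent to everything,
    k - 2a more vertices among which only a matching of s + 1 - r pairs is
    missing (none if s < r), where s = k - a, and n - s further vertices adjacent
    to the first a only ([extremal_graph]). A cycle meets the last kind of vertices at most a
    times, as it steps each time to one of the first a vertices. If it does so a
    times, it has only 2a < k vertices; otherwise it has at most
    (a - 1) + s = k - 1.

    Kopylov's lemma itself is proved by following the neighbours of the two ends
    along the path. If some neighbour of the last vertex precedes a neighbour of
    the first one, a closest such pair yields the cycle ([crossing_cycle]).
    Otherwise the neighbours of the first vertex lie in an initial segment A and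
    those of the last vertex in a final segment B of the path, and
    2-connectedness gives two disjoint paths between A and B that use the
    facing ends of both segments ([two_links]); each segment can be traversed
    between its two contact points so as to visit all the neighbours in it
    ([sweep]). *)

(** * Disjoint paths and long cycles *)

Section Links.
Variables (T : finType) (e : rel T).
Hypothesis esym : symmetric e.
Implicit Types (x y z a b : T) (p q : seq T) (A B : {set T}).

(** A path is a pair x, p standing for the sequence x :: p; reversed, its head is
   [last x p] and its tail is [rev (belast x p)]. *)
Lemma rev_tail x p : last x p :: rev (belast x p) = rev (x :: p).
Proof. by rewrite (lastI x p) rev_rcons. Qed.

Lemma path_rev_tail x p : path e x p -> path e (last x p) (rev (belast x p)).
Proof.
by move=> Pp; rewrite rev_path (eq_path (e' := e)).
Qed.

Lemma last_rev_tail x p : last (last x p) (rev (belast x p)) = x.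
Proof. by rewrite -[LHS]/(last x (_ :: _)) rev_tail rev_cons last_rcons. Qed.

(** An A-B path in the usual sense: only its first vertex is in A and only its
    last one is in B. It may consist of a single vertex of both sets. *)
Definition link A B x q :=
  [&& x \in A, path e x q, uniq (x :: q), last x q \in B,
      ~~ has [in A] q & ~~ has [in B] (belast x q)].

Lemma linkP A B x q : reflect
  [/\ x \in A, path e x q, uniq (x :: q), last x q \in B &
      {in q, forall w, w \notin A} /\ {in belast x q, forall w, w \notin B}]
  (link A B x q).
Proof.
apply: (iffP and5P) => [[-> -> -> -> /andP[/hasPn ? /hasPn ?]]|]; first by split.
by case=> -> -> -> -> [? ?]; split=> //; apply/andP; split; apply/hasPn.
Qed.

(** Start at the last visit to A, then stop at the first visit to B. *)
Lemma link_within A B x q : path e x q -> uniq (x :: q) ->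
  x \in A -> last x q \in B ->
  exists x' q', link A B x' q' /\ {subset x' :: q' <= x :: q}.
Proof.
have [m] := ubnP (size q); elim: m x q => // m IH x q Hm Pq Uq xA lB.
have [/hasP[z zq zA]|nA] := boolP (has [in A] q).
  case/splitPr: zq Hm Pq Uq lB => q1 q2; rewrite size_cat /= => Hm.
  rewrite cat_path last_cat /= => /and3P[_ _ Pq2].
  case/andP=> _; rewrite cat_uniq => /and3P[_ _ Uq2] lB.
  have [|x' [q' [lk sub]]] := IH z q2 _ Pq2 Uq2 zA lB; first by lia.
  exists x', q'; split=> // w /sub; rewrite -cat_cons mem_cat => ->.
  by rewrite orbT.
have [/hasP[z zq zB]|nB] := boolP (has [in B] (belast x q)); last first.
  exists x, q; split=> //; rewrite /link xA Pq lB nA nB /=.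
  by move: Uq => /= ->.
case/lastP: q Hm Pq Uq lB nA zq => // q y + + + _ _; rewrite belast_rcons => + + + zq.
case/splitPl: zq => q1 q2 lz; rewrite rcons_cat size_cat cat_path size_rcons.
move=> Hm /andP[Pq1 _]; rewrite -[x :: _]/((x :: q1) ++ _) cat_uniq => /andP[Uq1 _].
have [||x' [q' [lk sub]]] := IH x q1 _ Pq1 Uq1 xA; [by lia|by rewrite lz|].
exists x', q'; split=> // w /sub.
by rewrite !inE mem_cat => /orP[->//|->]; rewrite orbT.
Qed.

(** Rerouting step: walk along q up to the vertex where it first meets the path
    c :: r, then follow that path to its end. *)
Lemma splice A B x q c r : x \in A -> path e x q -> uniq (x :: q) ->
  {in q, forall w, w \notin A} -> path e c r -> uniq (c :: r) -> last c r \in B ->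
  {in r, forall w, w \notin A} -> {in belast c r, forall w, w \notin B} ->
  last x q \in c :: r ->
  {in belast x q, forall w, w \notin B} -> {in belast x q, forall w, w \notin c :: r} ->
  exists s, [/\ link A B x s, last x s = last c r & {subset x :: s <= (x :: q) ++ r}].
Proof.
move=> xA Pq Uq qA Pr Ur lB rA rB zr qB qr; case/splitPl: zr Pr Ur lB rA rB qr => r1 r2 lz.
rewrite cat_path last_cat belast_cat lz => /andP[_ Pr2] Ur lB rA rB qr.
have r2A : {in r2, forall w, w \notin A} by move=> w wr; rewrite rA // mem_cat wr orbT.
exists (q ++ r2); rewrite last_cat; split=> //; last first.
  by move=> w; rewrite -cat_cons !mem_cat => /orP[->//|->]; rewrite !orbT.
apply/linkP; split; rewrite ?last_cat ?cat_path ?Pq //.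
  have Eq : x :: q ++ r2 = belast x q ++ last x q :: r2 by rewrite -cat_rcons -lastI.
  have Er : c :: r1 ++ r2 = belast c r1 ++ last x q :: r2 by rewrite -cat_rcons -lz -lastI.
  move: Uq; rewrite lastI rcons_uniq => /andP[_ Uq].
  move: Ur qr; rewrite Er cat_uniq => /and3P[_ _ Ur] qr.
  rewrite Eq cat_uniq; apply/and3P; split=> //; apply/hasPn => w wr.
  by apply: contraL wr => /qr; rewrite mem_cat negb_or => /andP[].
split=> w; rewrite ?belast_cat mem_cat => /orP[].
- exact: qA.
- exact: r2A.
- exact: qB.
- by move=> wr; apply: rB; rewrite mem_cat wr orbT.
Qed.

Hypothesis conn2 : forall v x y, x != v -> y != v ->
  exists q, [/\ path e x q, last x q = y & v \notin x :: q].

Lemma link_avoiding A B v x y : x \in A -> x != v -> y \in B -> y != v ->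
  exists x' q, link A B x' q /\ v \notin x' :: q.
Proof.
move=> xA xv yB yv; have [q [Pq lq vq]] := conn2 xv yv.
case/shortenP: Pq lq => s Ps Us sub ls.
have [||x' [q' [lk sub']]] := @link_within (A :\ v) (B :\ v) x s Ps Us.
- by rewrite !inE xv.
- by rewrite ls !inE yv.
have vq' : v \notin x' :: q'.
  by apply: contra vq => /sub'; rewrite !inE => /orP[->//|/sub ->]; rewrite orbT.
exists x', q'; split=> //.
have sv C w : w \in x' :: q' -> (w \in C :\ v) = (w \in C).
  by move=> wq; rewrite !inE; case: eqP => // E; rewrite -E wq in vq'.
move: lk => /linkP[+ Pq' Uq' + [nA nB]]; rewrite !sv ?mem_head ?mem_last // => xA' lB.
apply/linkP; split=> //; split=> w wq.
  by rewrite -(sv A) ?nA // inE wq orbT.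
by rewrite -(sv B) ?nB // mem_belast.
Qed.

(** Menger's theorem for two paths, in the augmenting form: starting from one A-B
    path a :: p, there are two disjoint A-B paths whose ends still include both
    ends of a :: p. Menger's theorem alone would not control the ends.
    Induction on p: make the second vertex p1 a member of A. If the second of the
    two paths then obtained does not start at a, put a in front of the first one.
    If it does start at a, a further path from A that avoids a is followed until
    it meets one of the two paths or B, and replaces the initial part of the path
    that it meets. *)
Lemma two_links p : forall A B a, link A B a p ->
  (exists2 x, x \in A & x != a) -> (exists2 y, y \in B & y != last a p) ->
  exists a' r1 r2, [/\ link A B a r1, link A B a' r2,
     {in a' :: r2, forall w, w \notin a :: r1} & last a p \in [:: last a r1; last a' r2]].
Proof.
elim: p => [|p1 p IH] A B a.
  case/linkP=> aA _ _ aB _ [x xA xa] [y yB yb].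
  have [a' [q [lk aq]]] := link_avoiding xA xa yB yb.
  exists a', [::], q; split; rewrite ?inE ?eqxx //.
  - by rewrite /link aA aB.
  - by move=> w wq; rewrite inE; apply: contra aq => /eqP<-.
move=> /linkP[aA /= /andP[ea Pp] /andP[ap Up] lB [pA pB]] [x xA xa] exB.
have [aB pB'] : a \notin B /\ {in belast p1 p, forall w, w \notin B}.
  by split=> [|w wp]; apply: pB; rewrite inE ?eqxx // wp orbT.
have p1A : p1 \notin A by apply: pA; rewrite mem_head.
have ap1 : a != p1 by apply: contra ap => /eqP->; rewrite mem_head.
have [|||a' [r1 [r2 [lk1 lk2 dis ends]]]] := IH (p1 |: A) B p1.
- apply/linkP; split; rewrite ?inE ?eqxx //; split=> // w wp; rewrite !inE negb_or.
  rewrite pA ?andbT; last by rewrite inE wp orbT.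
  by apply: contraNneq (andP Up).1 => <-.
- by exists a; rewrite ?inE ?aA ?orbT.
- exact: exB.
case/linkP: lk1 => _ P1 U1 l1B [n1A n1B].
case/linkP: (lk2) => a'A P2 U2 l2B [n2A n2B].
have outA w : w \notin p1 |: A -> w \notin A.
  by rewrite !inE negb_or => /andP[].
have a'p1 : a' != p1 by have := dis _ (mem_head _ _); rewrite inE negb_or => /andP[].
have {}a'A : a' \in A by move: a'A; rewrite !inE (negPf a'p1).
have lk2' : link A B a' r2.
  by apply/linkP; split=> //; split=> // w /n2A/outA.
have r1a : a \notin p1 :: r1.
  rewrite inE negb_or ap1 /=; apply/negP => /n1A.
  by rewrite !inE aA orbT.
have lk1' : link A B a (p1 :: r1).
  apply/linkP; split=> //=; first by rewrite ea.
    by rewrite r1a.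
  split=> w; rewrite inE; first by case/orP=> [/eqP->|/n1A/outA].
  by case/orP=> [/eqP->|/n1B].
(* The second path starts in A elsewhere than at a: put a in front of the first. *)
have [Ea|a'a] := eqVneq a' a; last first.
  exists a', (p1 :: r1), r2; split=> // w wr.
  rewrite inE negb_or dis // andbT; move: wr; rewrite inE => /orP[/eqP->//|/n2A].
  by apply: contraNneq => ->; rewrite !inE aA orbT.
subst a'.
(* Both paths start at the beginning of a :: p; a third one, avoiding a, is
   stopped as soon as it meets them or B. *)
pose Z := [set w in p1 :: r1] :|: [set w in r2] :|: B.
have [y yB ya] : exists2 y, y \in Z & y != a.
  by exists p1; rewrite ?inE ?eqxx 1?eq_sym.
have [x' [q [/linkP[x'A Pq Uq lZ [qA qZ]] aq]]] := link_avoiding xA xa yB ya.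
have qB : {in belast x' q, forall w, w \notin B}.
  by move=> w /qZ; apply: contra => wB; rewrite !inE wB !orbT.
have q1 : {in belast x' q, forall w, w \notin p1 :: r1}.
  by move=> w /qZ; apply: contra; rewrite !inE => /orP[->|->]; rewrite ?orbT.
have q2 : {in belast x' q, forall w, w \notin a :: r2}.
  move=> w wq; rewrite inE negb_or; apply/andP; split.
    by apply: contraNneq aq => <-; rewrite mem_belast.
  by move: (qZ w wq); apply: contra => wr; rewrite !inE wr ?orbT.
have p1r1A : {in p1 :: r1, forall w, w \notin A}.
  by case/linkP: lk1' => _ _ _ _ [].
have r2A : {in r2, forall w, w \notin A} by case/linkP: lk2' => _ _ _ _ [].
have [z1|z1] := boolP (last x' q \in p1 :: r1).
  have r1A : {in r1, forall w, w \notin A} by move=> w wr; apply: p1r1A; rewrite inE wr orbT.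
  have [s [lks ls sub]] := splice x'A Pq Uq qA P1 U1 l1B r1A n1B z1 qB q1.
  exists x', r2, s; split=> //; last by move: ends; rewrite ls !inE orbC.
  move=> w /sub; rewrite mem_cat => /orP[|wr]; last first.
    by apply: contraTN wr => /dis; rewrite inE negb_or => /andP[].
  rewrite lastI mem_rcons inE => /orP[/eqP->|/q2//].
  by apply: contraTN z1 => /dis.
have [z2|z2] := boolP (last x' q \in r2).
  have U2a : last x' q \in a :: r2 by rewrite inE z2 orbT.
  have [s [lks ls sub]] := splice x'A Pq Uq qA P2 U2 l2B r2A n2B U2a qB q2.
  exists x', (p1 :: r1), s; split=> //=; last by rewrite ls.
  move=> w ws; rewrite inE negb_or; apply/andP; split.
    apply: contraTneq ws => ->; apply/negP => /sub; rewrite mem_cat (negPf aq) /= => ar.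
    by move: U2 => /=; rewrite ar.
  move: ws => /sub; rewrite mem_cat => /orP[|wr]; last by apply: dis; rewrite inE wr orbT.
  by rewrite lastI mem_rcons inE => /orP[/eqP->//|/q1].
(* The third path reaches B without meeting the other two: of these keep the one
   that ends where a :: p ends. *)
have zB : last x' q \in B.
  by move: lZ; rewrite !in_setU !in_set (negPf z1) (negPf z2).
have lkq : link A B x' q by apply/linkP.
have qZ' (C : seq T) : last x' q \notin C -> {in belast x' q, forall w, w \notin C} ->
    {in x' :: q, forall w, w \notin C}.
  by move=> zC qC w; rewrite lastI mem_rcons inE => /orP[/eqP->|/qC].
move: ends; rewrite !inE => /orP[/eqP Eb|/eqP Eb].
  exists x', (p1 :: r1), q; split=> //=; last by rewrite Eb !inE eqxx.
  move=> w wq; rewrite inE negb_or (qZ' (p1 :: r1)) // andbT.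
  by apply: contraNneq aq => <-.
exists x', r2, q; split=> //; last by rewrite /= Eb !inE eqxx.
move=> w wq; rewrite inE negb_or; apply/andP; split.
  by apply: contraNneq aq => <-.
apply: qZ' wq => // v /q2; by rewrite inE negb_or => /andP[].
Qed.

(** When both ends of the path x :: p are adjacent, one can travel from its last
    vertex to any other vertex z of it and visit on the way all neighbours of x that
    the path contains: go back along it to the first neighbour c of x after z,
    jump to x, and go forward to z. Only the vertices between z and c, which are
    not neighbours of x, are skipped. *)
Lemma sweep x p z : path e x p -> uniq (x :: p) -> e x (last x p) ->
  z \in x :: p -> z != last x p ->
  exists q, [/\ path e (last x p) q, last (last x p) q = z, uniq (last x p :: q),
    {subset last x p :: q <= x :: p} &
    {in x :: p, forall w, (w == x) || e x w -> w \in last x p :: q}].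
Proof.
move=> Pp Up exl zp; case/splitPl: zp Pp Up exl => u p2 lz.
rewrite cat_path last_cat lz => /andP[Pu P2] Up exl zl.
have hp : has (e x) p2.
  by apply/hasP; exists (last z p2) => //; move: (mem_last z p2); rewrite inE eq_sym (negPf zl).
case/split_find: hp P2 Up exl zl => c s1 s2 exc ns1.
rewrite cat_path last_cat last_rcons => /andP[_ P2] Up exl zl.
have Us2 : uniq (c :: s2).
  by move: Up; rewrite cat_rcons -cat_cons cat_uniq cat_uniq => /and3P[_ _ /and3P[]].
have dis : {in x :: u, forall w, w \notin c :: s2}.
  move=> w wu; move: Up.
  rewrite cat_rcons catA -[x :: _]/((x :: _) ++ _) cat_uniq => /and3P[_ /hasPn H _].
  by apply: contraTN wu => /H; rewrite /= -cat_cons mem_cat negb_or => /andP[].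
exists (rev (belast c s2) ++ x :: u); split.
- by rewrite cat_path path_rev_tail //= last_rev_tail esym exc.
- by rewrite last_cat.
- rewrite -cat_cons rev_tail cat_uniq rev_uniq Us2 andTb; apply/andP; split.
    by apply/hasPn => w /dis; rewrite mem_rev.
  by move: Up; rewrite -cat_cons cat_uniq => /and3P[].
- move=> w; rewrite -cat_cons rev_tail mem_cat mem_rev cat_rcons -[in X in _ -> X]cat_cons.
  by rewrite mem_cat [in X in _ -> X]mem_cat => /orP[->|->]; rewrite ?orbT.
- move=> w; rewrite -[last c s2 :: _]/((last c s2 :: _) ++ _) rev_tail mem_cat mem_rev.
  rewrite cat_rcons -cat_cons !mem_cat => /or3P[->|ws1|->]; rewrite ?orbT //.
  have /negPf-> : ~~ e x w by apply: (hasPn ns1).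
  by rewrite orbF => /eqP->; rewrite mem_head orbT.
Qed.


(** The cycle runs forward through p1, jumps to the end of the path, comes back
    to c and closes at x; only m is left out. *)
Lemma crossing_cycle x p1 m c p2 : path e x (p1 ++ m ++ c :: p2) ->
  uniq (x :: p1 ++ m ++ c :: p2) -> e (last x p1) (last c p2) -> e x c ->
  cycle e (x :: p1 ++ rev (c :: p2)) /\ uniq (x :: p1 ++ rev (c :: p2)).
Proof.
rewrite !cat_path => /and3P[P1 _ /andP[_ P2]] U e1 e2; split.
  rewrite -rev_tail /= rcons_cat cat_path P1 /= e1 rcons_path path_rev_tail //=.
  by rewrite last_rev_tail esym.
have Up : perm_eq (x :: p1 ++ rev (c :: p2)) (x :: p1 ++ c :: p2).
  by rewrite -[x :: _]/((x :: p1) ++ _) perm_cat2l perm_rev.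
rewrite (perm_uniq Up); apply: subseq_uniq U.
by apply: (@cat_subseq _ (x :: p1) _ (x :: p1)) => //; apply: suffix_subseq.
Qed.

Hypothesis eirr : irreflexive e.

Lemma closed_walk_cycle a c : path e a c -> last a c = a -> cycle e c.
Proof. by case: c => //= b c /andP[eb Pc] la; rewrite rcons_path Pc la. Qed.

(** Two disjoint links between the initial segment x :: p1 and the final segment
    b :: p2, obtained from the middle part q, are closed up by sweeping through
    both segments. *)
Lemma noncrossing_cycle x p1 q p2 :
  let a := last x p1 in let b := last a q in let y := last b p2 in
  path e x (p1 ++ q ++ p2) -> uniq (x :: p1 ++ q ++ p2) -> e x a -> e y b ->
  exists c, [/\ cycle e c, uniq c,
    {in x :: p1, forall w, (w == x) || e x w -> w \in c} &
    {in b :: p2, forall w, (w == y) || e y w -> w \in c}].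
Proof.
move=> a b y; rewrite !cat_path -/a -/b => /and3P[P1 Pq P2] U exa eyb.
have Ua : uniq (belast x p1 ++ a :: q ++ p2).
  by rewrite -cat_rcons -lastI.
have Ub : uniq (belast x p1 ++ belast a q ++ b :: p2).
  by rewrite -[belast a q ++ _]cat_rcons -lastI.
have xa : x != a by apply: contraTneq exa => <-; rewrite eirr.
have yb : y != b by apply: contraTneq eyb => <-; rewrite eirr.
pose A := [set w in x :: p1]; pose B := [set w in b :: p2].
have lk : link A B a q.
  apply/linkP; split=> //; rewrite ?in_set ?mem_last //.
  - by move: Ua; rewrite -cat_cons catA cat_uniq cat_uniq => /andP[/and3P[]].
  - by rewrite mem_head.
  split=> w wq; rewrite in_set; apply/negP => wi.
    move: U; rewrite -cat_cons cat_uniq => /and3P[_ /hasPn H _].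
    by move: (H w); rewrite mem_cat wq wi => /(_ isT).
  move: Ub; rewrite cat_uniq cat_uniq => /and3P[_ _ /and3P[_ /hasPn H _]].
  by move: (H w wi); rewrite wq.
have [||a' [r1 [r2 [lk1 lk2 dis ends]]]] := two_links lk.
- by exists x; rewrite // in_set mem_head.
- by exists y; rewrite // in_set mem_last.
case/linkP: lk1 => _ R1 U1; rewrite in_set => e1B [n1A n1B].
case/linkP: lk2; rewrite in_set => a'A R2 U2; rewrite in_set => e2B [n2A n2B].
set e1 := last a r1 in e1B ends; set e2 := last a' r2 in e2B ends.
have e12 : e1 != e2.
  have : e2 \notin a :: r1 := dis _ (mem_last a' r2).
  by apply: contraNneq => <-; rewrite mem_last.
have a'a : a' != a.
  have : a' \notin a :: r1 := dis _ (mem_head a' r2).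
  by apply: contraNneq => ->; rewrite mem_head.
have [q1 [Q1 l1 V1 sub1 cov1]] : exists q1, [/\ path e a q1, last a q1 = a', uniq (a :: q1),
    {subset a :: q1 <= x :: p1} &
    {in x :: p1, forall w, (w == x) || e x w -> w \in a :: q1}].
  by apply: sweep => //; move: U; rewrite -cat_cons cat_uniq => /and3P[].
pose bt := rev (belast b p2).
have Ebt : y :: bt = rev (b :: p2) by rewrite /bt -rev_tail.
have lbt : last y bt = b by rewrite /bt last_rev_tail.
have sweepB b' : b' \in b :: p2 -> b' != b -> exists q2, [/\ path e b q2, last b q2 = b',
    uniq (b :: q2), {subset b :: q2 <= b :: p2} &
    {in b :: p2, forall w, (w == y) || e y w -> w \in b :: q2}].
  move=> b'B b'b; have := @sweep y bt b'; rewrite lbt Ebt mem_rev rev_uniq.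
  case=> //; first exact: path_rev_tail.
    by move: Ub; rewrite cat_uniq cat_uniq => /and3P[_ _ /and3P[]].
  move=> q2 [? ? ? s2 c2]; exists q2; split=> // w.
    by move/s2; rewrite mem_rev.
  by move=> wp; apply: c2; rewrite mem_rev.
have [w2 [W2 l2 V2 sub2 cov2]] : exists w2, [/\ path e e2 w2, last e2 w2 = e1,
    uniq (e2 :: w2), {subset e2 :: w2 <= b :: p2} &
    {in b :: p2, forall w, (w == y) || e y w -> w \in e2 :: w2}].
  move: ends; rewrite !inE => /orP[/eqP Eb|/eqP Eb]; last first.
    by rewrite -Eb in e12 *; apply: sweepB.
  rewrite -/b in Eb; have [|q2 [Q2 l2 V2 s2 c2]] := sweepB e2 e2B; first by rewrite Eb eq_sym.
  exists (rev (belast b q2)); rewrite -l2 rev_tail rev_uniq last_rev_tail path_rev_tail //.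
  split=> // w; first by rewrite mem_rev; apply: s2.
  by rewrite mem_rev; apply: c2.
(* A closed walk from a: its starting point is not repeated at the head of c,
   but is the last vertex of c; this also covers the case a = b. *)
pose c := q1 ++ r2 ++ w2 ++ rev (belast a r1).
have Pc : path e a c by rewrite !cat_path Q1 l1 R2 W2 -/e2 l2 path_rev_tail.
have lc : last a c = a by rewrite !last_cat l1 -/e2 l2 last_rev_tail.
have q10 : q1 != [::] by apply: contraNneq a'a => q0; rewrite -l1 q0.
have ac : a \in c.
  have c0 : c != [::] by rewrite /c; case: (q1) q10.
  by move: lc c0; case: (c) => //= u q' lu _; rewrite -[X in X \in _]lu mem_last.
exists c; split.
- exact: closed_walk_cycle Pc lc.
- have AB w : w \in x :: p1 -> w \in b :: p2 -> w = a.
    rewrite lastI mem_rcons inE => /orP[/eqP//|wp] wB.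
    move: Ua; rewrite cat_uniq => /and3P[_ /hasPn H _]; move: (H w); rewrite wp => /(_ _)/negP[] //.
    rewrite -cat_cons mem_cat; move: wB; rewrite inE => /orP[/eqP->|->]; rewrite ?orbT //.
    by rewrite mem_last.
  have aq1 : a \notin q1 by move: V1 => /andP[].
  have e2w2 : e2 \notin w2 by move: V2 => /andP[].
  have q1A w : w \in q1 -> w \in x :: p1 by move=> wq; apply: sub1; rewrite inE wq orbT.
  have w2B w : w \in w2 -> w \in b :: p2 by move=> wq; apply: sub2; rewrite inE wq orbT.
  have bl w : w \in rev (belast a r1) -> w \in a :: r1 /\ w \notin b :: p2.
    rewrite mem_rev => wr; split; first exact: mem_belast.
    by have := n1B w wr; rewrite in_set.
  rewrite !cat_uniq; apply/and5P; split.
  + by move: V1 => /andP[].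
  + apply/hasPn => w wc; apply/negP => /= wq.
    have wa : w != a by apply: contraNneq aq1 => <-.
    move: wc; rewrite !mem_cat => /or3P[wr|ww|/bl[]].
    * by have := n2A w wr; rewrite in_set q1A.
    * by case/eqP: wa; apply: AB; [apply: q1A|apply: w2B].
    * rewrite inE (negPf wa) /= => wr _.
      by have := n1A w wr; rewrite in_set q1A.
  + by move: U2 => /andP[].
  + apply/hasPn => w wc; apply/negP => /= wr.
    move: wc; rewrite !mem_cat => /orP[ww|/bl[wr1 _]]; last first.
      by have := dis w; rewrite inE wr orbT wr1 => /(_ isT).
    have := w2B w ww; have : w \in a' :: r2 by rewrite inE wr orbT.
    rewrite lastI mem_rcons inE -/e2 => /orP[/eqP E|/n2B]; first by rewrite -E ww in e2w2.
    by rewrite in_set => /negPf->.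
  apply/and3P; split.
  + by move: V2 => /andP[].
  + by apply/hasPn => w /bl[_]; apply: contra => /w2B.
  by rewrite rev_uniq; move: U1; rewrite lastI rcons_uniq => /andP[].
- move=> w wp hw; move: (cov1 w wp hw); rewrite inE => /orP[/eqP->//|].
  by rewrite mem_cat => ->.
move=> w wp hw; move: (cov2 w wp hw); rewrite inE => /orP[/eqP->|ww]; last first.
  by rewrite !mem_cat ww !orbT.
have := mem_last a' r2; rewrite inE -/e2 => /orP[/eqP->|er]; last by rewrite !mem_cat er !orbT.
have := mem_last a q1; rewrite inE l1 (negPf a'a) /= => aq.
by rewrite mem_cat aq.
Qed.

Lemma split_last_has (a : pred T) (s : seq T) : has a s ->
  exists s1 z s2, [/\ s = rcons s1 z ++ s2, a z & ~~ has a s2].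
Proof.
elim: s => //= w s IH; have [hs _|ns] := boolP (has a s); last first.
  by rewrite orbF => aw; exists [::], w, s.
by have [s1 [z [s2 [-> az n2]]]] := IH hs; exists (w :: s1), z, s2.
Qed.

Lemma path_splits (r : rel T) x p :
  (forall s1 w s2, p = s1 ++ w :: s2 -> r (last x s1) w) -> path r x p.
Proof.
elim: p x => //= w p IH x H; rewrite (H [::] w p) //=; apply: IH => s1 v s2 E.
by apply: (H (w :: s1) v s2); rewrite E.
Qed.

(** Along a path, shifting the vertices satisfying P by one step makes them
    disjoint from those satisfying Q. *)
Lemma count_no_consecutive (P Q : pred T) x p :
  path (fun u w => ~~ (P u && Q w)) x p ->
  count Q p + count P (belast x p) <= size p.
Proof.
elim: p x => //= w p IH x /andP[H /IH].
by case: (P x) (Q w) H => [] [] //= _; lia.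
Qed.

(** Kopylov's lemma. If the neighbours of the two ends cross, a crossing pair
    with the fewest vertices m in between is chosen. If m is empty, the cycle
    contains the whole path. Otherwise m contains no neighbour of either end and
    no two consecutive vertices of the path cross, so that the vertices outside m
    are at least as many as the neighbours counted. *)
Theorem long_cycle x p k : 0 < size p -> path e x p -> uniq (x :: p) -> ~~ e x (last x p) ->
  k <= size (x :: p) -> k <= count (e x) p + count (e (last x p)) (x :: p) ->
  exists c, [/\ cycle e c, uniq c & k <= size c].
Proof.
move=> p0 Pp Up nxy; set y := last x p in nxy *.
have -> : count (e y) (x :: p) = count (e y) (belast x p).
  by rewrite lastI -cats1 count_cat /= -/y eirr !addn0.
move=> kp kd.
pose cross p1 m c p2 := [/\ p = p1 ++ m ++ c :: p2, e y (last x p1) & e x c].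
pose R n := exists p1 m c p2, cross p1 m c p2 /\ size m = n.
have [[n Rn]|noR] := pselect (exists n, R n).
  have exR : exists n, `[< R n >] by exists n; apply/asboolP.
  case: (ex_minnP exR) => {n Rn exR} n /asboolP[p1 [m [c [p2 [[Ep ey ex] sm]]]]] minn.
  have {}minn p1' m' c' p2' : cross p1' m' c' p2' -> n <= size m'.
    by move=> H; apply: minn; apply/asboolP; exists p1', m', c', p2'.
  have Ey : last c p2 = y by rewrite /y Ep !last_cat.
  have [||||H1 H2] := @crossing_cycle x p1 m c p2; rewrite -?Ep ?Ey // 1?esym //.
  exists (x :: p1 ++ rev (c :: p2)); split=> //.
  rewrite /= size_cat size_rev /=.
  have [n0|n0] := posnP n.
    by rewrite n0 in sm; move: kp; rewrite Ep (size0nil sm) /= size_cat.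
  have nQ : count (e x) m = 0.
    apply/eqP; rewrite -leqn0 leqNgt -has_count; apply/hasPn => w wm; apply/negP => xw.
    case/splitPr: wm sm Ep => m1 m2 sm Ep.
    have := minn p1 m1 w (m2 ++ c :: p2); rewrite -sm size_cat /=.
    have H : cross p1 m1 w (m2 ++ c :: p2) by split=> //; rewrite Ep -!catA.
    by move=> /(_ H); clear; lia.
  have nP : count (e y) m = 0.
    apply/eqP; rewrite -leqn0 leqNgt -has_count; apply/hasPn => w wm; apply/negP => yw.
    case/splitPr: wm sm Ep => m1 m2 sm Ep.
    have := minn (p1 ++ rcons m1 w) m2 c p2; rewrite -sm size_cat /=.
    have H : cross (p1 ++ rcons m1 w) m2 c p2.
      by split=> //; rewrite ?last_cat ?last_rcons // Ep -!catA cat_rcons.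
    by move=> /(_ H); clear; lia.
  have c1 : count (e x) p1 + count (e y) (belast x p1) <= size p1.
    apply: count_no_consecutive; apply: path_splits => s1 w s2 E1; apply/negP => /andP[yw xw].
    have := minn s1 [::] w (s2 ++ m ++ c :: p2); rewrite leqn0.
    have H : cross s1 [::] w (s2 ++ m ++ c :: p2) by split=> //; rewrite Ep E1 -!catA.
    by move=> /(_ H)/eqP; move: n0; clear; lia.
  have c2 : count (e x) p2 + count (e y) (belast c p2) <= size p2.
    apply: count_no_consecutive; apply: path_splits => s1 w s2 E1; apply/negP => /andP[yw xw].
    have := minn (p1 ++ m ++ c :: s1) [::] w s2; rewrite leqn0.
    have H : cross (p1 ++ m ++ c :: s1) [::] w s2.
      by split=> //; rewrite ?last_cat //= Ep E1 -!catA.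
    by move=> /(_ H)/eqP; move: n0; clear; lia.
  apply: leq_trans kd _.
  have -> : belast x p = belast x p1 ++ last x p1 :: m ++ belast c p2.
    by rewrite Ep belast_cat; congr (_ ++ _); elim: (m) (last x p1) => [|w m' IH] u //=; rewrite IH.
  rewrite Ep !count_cat /= !count_cat nQ nP ex ey /=.
  by move: c1 c2; lia.
(* From here on no two neighbours cross. The path is cut at the last neighbour z
   of its first vertex and at the first neighbour last z q of its last vertex. *)
have {}noR p1 m c p2 : p = p1 ++ m ++ c :: p2 -> e y (last x p1) -> e x c -> False.
  by move=> Ep H1 H2; apply: noR; exists (size m), p1, m, c, p2.
have hx : has (e x) p by case: (p) p0 Pp => //= u p' _ /andP[->].
have [s [z [rest [Ep exz nrest]]]] := split_last_has hx.
have hy : has (e y) (belast x p).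
  have [p' [u Eu]] : exists p' u, p = rcons p' u.
    by case/lastP: (p) p0 => // p' u; exists p', u.
  have yu : y = u by rewrite /y Eu last_rcons.
  move: Pp; rewrite Eu rcons_path belast_rcons -yu esym => /andP[_ ev].
  by apply/hasP; exists (last x p'); rewrite ?mem_last.
have hy0 : ~~ has (e y) (belast x (rcons s z)).
  rewrite belast_rcons; apply/hasPn => w ws; apply/negP => yw.
  case/splitPl: ws Ep => s1 s2 lw Ep.
  by apply: (noR s1 s2 z rest); rewrite ?lw // Ep cat_rcons -catA.
have hy1 : has (e y) (z :: rest).
  move: hy; rewrite {1}Ep belast_cat has_cat (negPf hy0) last_rcons orFb => /hasP[w wr yw].
  by apply/hasP; exists w => //; apply: mem_belast.
have [q [p2 [Er yb nq]]] : exists q p2,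
    [/\ rest = q ++ p2, e y (last z q) & count (e y) (belast z q) = 0].
  move El: (z :: rest) hy1 => l hl; case/split_find: hl El => b s1 s2 yb ns1.
  case: s1 ns1 => [|z' s1] ns1 [-> ->].
    by exists [::], s2.
  exists (rcons s1 b), s2; rewrite last_rcons belast_rcons; split=> //.
  by apply/eqP; rewrite -leqn0 leqNgt -has_count.
move: Ep; rewrite Er => Ep; set p1 := rcons s z in Ep.
have lz : last x p1 = z by rewrite last_rcons.
have ly : last (last z q) p2 = y by rewrite /y Ep !last_cat lz.
have [||||c [Cc Uc cx cy]] := @noncrossing_cycle x p1 q p2; rewrite -?Ep ?lz ?ly //.
move: cy; rewrite lz ly => cy; exists c; split=> //.
have nr : ~~ has (e x) (q ++ p2) by rewrite -Er.
(* The vertex last z q may be adjacent to both ends of the path, so it is counted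
   only once; the vertex x makes up for the loss. *)
pose S := (x :: filter (e x) p1) ++ filter (e y) p2.
have US : uniq S.
  have : subseq S (x :: p1 ++ q ++ p2).
    apply: (@cat_subseq _ (x :: filter (e x) p1) _ (x :: p1)).
      by rewrite /= eqxx filter_subseq.
    apply: subseq_trans (suffix_subseq q p2); exact: filter_subseq.
  by move/subseq_uniq; apply; rewrite -Ep.
have SC : {subset S <= c}.
  move=> w; rewrite mem_cat inE !mem_filter => /orP[/orP[/eqP->|/andP[xw wp]]|/andP[yw wp]].
  - by apply: cx; rewrite ?mem_head ?eqxx.
  - by apply: cx; rewrite ?xw ?orbT // inE wp orbT.
  - by apply: cy; rewrite ?yw ?orbT // inE wp orbT.
apply: leq_trans kd _; apply: leq_trans (uniq_leq_size US SC).
rewrite size_cat /= !size_filter Ep count_cat.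
have /eqP-> : count (e x) (q ++ p2) == 0 by rewrite -leqn0 leqNgt -has_count.
have -> : count (e y) (belast x (p1 ++ q ++ p2)) =
    count (e y) (belast x p1) + (count (e y) (belast z q) + count (e y) (belast (last z q) p2)).
  by rewrite !belast_cat !count_cat lz.
rewrite nq add0n.
have /eqP-> : count (e y) (belast x p1) == 0 by rewrite -leqn0 leqNgt -has_count.
have : count (e y) (belast (last z q) p2) <= count (e y) (last z q :: p2).
  by rewrite [X in _ <= count _ X]lastI -cats1 count_cat leq_addr.
by rewrite /= yb; clear; lia.
Qed.
End Links.

(** * Cores of edge-maximal graphs without long cycles *)

Section Core.
Variables (T : finType) (e : rel T).
Implicit Types (x y z : T) (S X Y : {set T}) (d : nat).

Definition dense d S := [forall x in S, d < #|[set z in S | e x z]|].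

(** Largest [dense d] set; it is also what remains after repeatedly deleting
    vertices of degree at most d. *)
Definition core d := \bigcup_(S : {set T} | dense d S) S.

Lemma denseP d S : reflect {in S, forall x, d < #|[set z in S | e x z]|} (dense d S).
Proof. exact: forall_inP. Qed.

Lemma dense_sub_core d S : dense d S -> S \subset core d.
Proof. by move=> dS; apply: bigcup_sup. Qed.

Lemma dense_core d : dense d (core d).
Proof.
apply/denseP => x /bigcupP[S dS xS]; apply: leq_trans (denseP _ _ dS x xS) _.
apply/subset_leq_card/subsetP => z; rewrite !inE => /andP[zS ->]; rewrite andbT.
by apply: (subsetP (dense_sub_core dS)).
Qed.

Lemma core_mono d d' : d <= d' -> core d' \subset core d.
Proof.
move=> dd'; apply: dense_sub_core; apply/denseP => x /(denseP _ _ (dense_core d')).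
exact: leq_ltn_trans.
Qed.

Lemma clique_cycle (s : seq T) : 1 < size s -> uniq s ->
  {in s &, forall x y, x != y -> e x y} -> cycle e s.
Proof.
case: s => [//|x [//|y s]] _ U H.
have sorted_s : sorted e (x :: y :: s).
  apply: pairwise_sorted; move: (U); rewrite uniq_pairwise.
  by apply: (@sub_in_pairwise _ [in x :: y :: s]); [move=> u v ? ?; apply: H|apply/allP].
rewrite (cycle_path x) /= in sorted_s *; rewrite sorted_s andbT.
apply: H; rewrite ?mem_head //; first by rewrite inE mem_last orbT.
by apply: contraTneq U => <-; rewrite /= mem_last.
Qed.

Hypothesis esym : symmetric e.
Hypothesis eirr : irreflexive e.
Hypothesis conn2 : forall v x y, x != v -> y != v ->
  exists q, [/\ path e x q, last x q = y & v \notin x :: q].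
Hypothesis T3 : 2 < #|T|.

(** Minimum degree two: if all neighbours of x were equal to v, then removing v
    would separate x from the rest. *)
Lemma dense_setT : dense 1 [set: T].
Proof.
have third x y : exists w, w != x /\ w != y.
  have : 0 < #|~: [set x; y]|.
    by rewrite cardsCs setCK cards2; move: T3; case: (x != y) => /=; lia.
  by case/card_gt0P => w; rewrite !inE negb_or => /andP[]; exists w.
have nbr x v : x != v -> exists u, u != v /\ e x u.
  move=> xv; have [z [zx zv]] := third x v.
  have [[|u q] [/= Pq lq vq]] := conn2 xv zv; first by rewrite lq eqxx in zx.
  exists u; move: Pq vq; rewrite !inE !negb_or => /andP[-> _] /and3P[_ vu _].
  by rewrite eq_sym.
apply/denseP => x _; have [v [vx _]] := third x x.
have [u [_ xu]] := nbr x v (negbT (etrans (eq_sym x v) (negPf vx))).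
have [w [wu xw]] : exists w, w != u /\ e x w.
  by apply: nbr; apply: contraTneq xu => ->; rewrite eirr.
apply: leq_trans (_ : #|[set u; w]| <= _); first by rewrite cards2 eq_sym wu.
by apply/subset_leq_card/subsetP => z; rewrite !inE => /orP[]/eqP->.
Qed.

Variable k : nat.
Hypothesis nocyc : forall c, cycle e c -> uniq c -> size c < k.
Hypothesis sat : forall x y, x != y -> ~~ e x y ->
  exists p, [/\ path e x p, uniq (x :: p), last x p = y & k <= size (x :: p)].

(** Take a longest path between non-adjacent x in X and y in Y. A neighbour x' of
    x in X outside of the path would extend it: to a cycle that is too long if x'
    is adjacent to y, to a longer path of the same kind otherwise. So the path
    contains all neighbours of x in X and of y in Y, and [long_cycle] applies. *)
Lemma dense_joined X Y dX dY : dense dX X -> dense dY Y -> k <= dX + dY + 2 ->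
  {in X & Y, forall x y, x != y -> e x y}.
Proof.
move=> /denseP DX /denseP DY hk x0 y0 x0X y0Y xy0; apply/negPn/negP => ne0.
pose R n := exists x y p, [/\ x \in X, y \in Y, x != y, ~~ e x y &
  [/\ path e x p, uniq (x :: p), last x p = y & size (x :: p) = n]].
have [p0 [P0 U0 l0 k0]] := sat xy0 ne0.
have R0 : `[< R (size (x0 :: p0)) >] by apply/asboolP; exists x0, y0, p0.
have Rb n : `[< R n >] -> n <= #|T|.
  move=> /asboolP[x [y [p [_ _ _ _ [_ U _ <-]]]]].
  by rewrite -(card_uniqP U) max_card.
have exR : exists n, `[< R n >] by exists (size (x0 :: p0)).
case: (ex_maxnP exR Rb) => n /asboolP[x [y [p [xX yY xy nxy [P U l sn]]]]] maxn.
have {}maxn x' y' p' : x' \in X -> y' \in Y -> x' != y' -> ~~ e x' y' ->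
    path e x' p' -> uniq (x' :: p') -> last x' p' = y' -> size (x' :: p') <= n.
  by move=> *; apply: maxn; apply/asboolP; exists x', y', p'.
have kn : k <= n by apply: leq_trans k0 _; apply: (maxn x0 y0).
have inp x' : x' \in X -> e x x' -> x' \in p.
  move=> x'X xx'; apply/negPn/negP => x'p.
  have x'x : x' != x by apply: contraTneq xx' => ->; rewrite eirr.
  have U' : uniq (x' :: x :: p) by rewrite cons_uniq U inE negb_or x'x x'p.
  have P' : path e x' (x :: p) by rewrite /= P esym xx'.
  have x'y : x' != y.
    by apply: contraNneq x'p => ->; move: (mem_last x p); rewrite l inE eq_sym (negPf xy).
  have [ex'y|nx'y] := boolP (e x' y).
    have /nocyc/(_ U') : cycle e (x' :: x :: p).
      by rewrite /= rcons_path l esym xx' P esym ex'y.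
    by move: kn sn; clear => /=; lia.
  by have := maxn x' y _ x'X yY x'y nx'y P' U' l; move: kn sn; clear => /=; lia.
have inq y' : y' \in Y -> e y y' -> y' \in x :: p.
  move=> y'Y yy'; apply/negPn/negP => y'p.
  have U' : uniq (x :: rcons p y').
    by rewrite -rcons_cons rcons_uniq y'p U.
  have P' : path e x (rcons p y') by rewrite rcons_path P l.
  have xy' : x != y' by apply: contraNneq y'p => <-; rewrite mem_head.
  have [exy'|nxy'] := boolP (e x y').
    have /nocyc/(_ U') : cycle e (x :: rcons p y').
      by rewrite /= rcons_path P' last_rcons esym.
    by move: kn sn; rewrite /= size_rcons; clear; lia.
  have := maxn x y' _ xX y'Y xy' nxy' P' U' (last_rcons _ _ _).
  by move: kn sn; rewrite /= size_rcons; clear; lia.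
have cX : dX < count (e x) p.
  apply: leq_trans (DX x xX) _; rewrite -size_filter; apply: leq_trans (card_size _).
  apply/subset_leq_card/subsetP => z; rewrite !inE mem_filter => /andP[zX xz].
  by rewrite xz inp.
have cY : dY < count (e y) (x :: p).
  apply: leq_trans (DY y yY) _; rewrite -size_filter; apply: leq_trans (card_size _).
  apply/subset_leq_card/subsetP => z; rewrite inE mem_filter => /andP[zX xz].
  by rewrite xz inq.
have p0' : 0 < size p by case: (p) l xy => //= ->; rewrite eqxx.
have [||||||c [Cc Uc]] := @long_cycle T e esym conn2 eirr x p k => //.
- by rewrite l.
- by rewrite sn.
- by rewrite l; move: cX cY hk; clear; lia.
by rewrite leqNgt nocyc.
Qed.

(** Let W be the t-core, a clique, and d = k - |W|. Being a clique, W is dense of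
    order |W| - 2, so every vertex of the d-core is joined to all of W; then it
    could be added to W. The value d = 1 is impossible because the 1-core is the
    whole vertex set, which has at least k vertices. *)
Theorem core_structure t : k <= 2 * t + 2 -> k <= #|T| -> core t != set0 ->
  exists d, [/\ 2 <= d <= t, #|core t| + d = k & core d = core t].
Proof.
move=> kt kT; set W := core t => /set0Pn[x0 x0W].
have DW : dense t W by apply: dense_core.
have clW : {in W &, forall x y, x != y -> e x y} by apply: (dense_joined DW DW); lia.
have WN x : x \in W -> [set z in W | e x z] = W :\ x.
  move=> xW; apply/setP => z; rewrite !inE andbC.
  case: eqP => [->|/eqP zx]; first by rewrite eirr.
  by case: (boolP (z \in W)) => zW; rewrite ?andbF // clW // eq_sym.
have sW : t + 2 <= #|W|.
  by move: (denseP _ _ DW x0 x0W); rewrite WN // [#|W|](cardsD1 x0) x0W; lia.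
have sk : #|W| < k.
  rewrite cardE; apply: nocyc (enum_uniq _); apply: clique_cycle.
  - by rewrite -cardE; lia.
  - exact: enum_uniq.
  - by move=> x y; rewrite !mem_enum; apply: clW.
have D2 : dense (#|W| - 2) W.
  apply/denseP => x xW; rewrite WN //; move: sW; rewrite [#|W|](cardsD1 x) xW; lia.
set d := k - #|W|.
have jW : {in core d & W, forall x y, x != y -> e x y}.
  by apply: (dense_joined (dense_core d) D2); lia.
have cdW : core d = W.
  have subW : W \subset core d by apply: core_mono; lia.
  apply/eqP; rewrite eqEsubset subW andbT.
  apply/subsetP => x xd; apply/negPn/negP => xW.
  have : dense t (x |: W).
    apply/denseP => y; rewrite !inE => /orP[/eqP->|yW].
      apply: leq_trans (_ : #|W| <= _); first by lia.
      apply/subset_leq_card/subsetP => z zW; rewrite !inE zW orbT.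
      by apply: jW => //; apply: contraNneq xW => ->.
    apply: leq_trans (denseP _ _ DW y yW) _.
    by apply/subset_leq_card/subsetP => z; rewrite !inE => /andP[->->]; rewrite orbT.
  by move/dense_sub_core/subsetP/(_ x); rewrite !inE eqxx => /(_ isT); apply/negP.
exists d; split=> //; last by lia.
apply/andP; split; last by lia.
rewrite ltnNge; apply/negP => d1.
have : core 1 \subset W by rewrite -cdW core_mono.
move/(subset_trans (dense_sub_core dense_setT))/subset_leq_card.
by rewrite cardsT; lia.
Qed.
End Core.

(** * Counting edges along a core *)

Section Count.
Variables (T : finType) (E : {set {set T}}).
Hypothesis E2 : {in E, forall f : {set T}, #|f| = 2}.
Implicit Types (U S : {set T}) (f : {set T}).

Definition inside U := #|[set f in E | f \subset U]|.

Lemma inside_setT : inside setT = #|E|.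
Proof. by apply: eq_card => f; rewrite !inE subsetT andbT. Qed.

Lemma inside_nonedges U :
  inside U + #|[set f : {set T} | f \subset U & #|f| == 2] :\: E| = 'C(#|U|, 2).
Proof.
rewrite -cards_draws -(cardsID E [set f : {set T} | f \subset U & #|f| == 2]).
congr (_ + _); apply: eq_card => f; rewrite !inE.
case: (boolP (f \in E)) => fE; rewrite ?andbF // (E2 fE) /=.
by rewrite !andbT.
Qed.

Lemma inside_bin U : inside U <= 'C(#|U|, 2).
Proof. by rewrite -inside_nonedges leq_addr. Qed.

(** Choose one end c f of every missing pair f in S; the vertices of S that are not
    chosen form a clique. *)
Lemma inside_clique_free r S :
  (forall D : {set T}, {in D &, forall x y, x != y -> [set x; y] \in E} -> #|D| < r) ->
  inside S + (#|S| + 1 - r) <= 'C(#|S|, 2).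
Proof.
move=> noK; rewrite -inside_nonedges leq_add2l; set N := _ :\: E.
have [->|[x0 x0S]] := set_0Vmem S.
  have r0 : 0 < r by have := noK set0; rewrite cards0; apply=> x; rewrite inE.
  by rewrite cards0; lia.
pose c f := odflt x0 [pick x in f].
have := noK (S :\: c @: N); rewrite cardsD.
have cN : #|S :&: c @: N| <= #|N|.
  by apply: leq_trans (leq_imset_card c N); apply/subset_leq_card/subsetIr.
suff H : {in S :\: c @: N &, forall x y, x != y -> [set x; y] \in E}.
  by move=> /(_ H); move: cN; set a := #|_ :&: _|; set b := #|N|; clearbody a b; clear; lia.
move=> x y; rewrite !inE => /andP[xc xS] /andP[yc yS] xy; apply/negPn/negP => nE.
have fN : [set x; y] \in N.
  rewrite !inE nE cards2 xy eqxx andbT.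
  by apply/subsetP => z; rewrite !inE => /orP[]/eqP->.
have : c [set x; y] \in c @: N by apply: imset_f.
rewrite {1}/c; case: pickP => [z|/(_ x)]; last by rewrite !inE eqxx.
by rewrite !inE => /orP[]/eqP-> /=; apply/negP.
Qed.

Variable e : rel T.
Hypothesis Ee : forall x y, [set x; y] \in E -> e x y.

Lemma inside_delete x U : inside U <= inside (U :\ x) + #|[set z in U | e x z]|.
Proof.
apply: leq_trans (leq_add (leqnn _) (leq_imset_card (fun z => [set x; z]) _)).
apply: leq_trans (leq_card_setU _ _); apply/subset_leq_card/subsetP => f.
rewrite in_set => /andP[fE fU]; rewrite in_setU.
have [xf|xf] := boolP (x \in f); apply/orP; [right|left]; last first.
  by rewrite inE fE subsetD1 fU.
have /eqP/cards2P[a [b [ab Ef]]] := E2 fE.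
have key z : f = [set x; z] -> f \in [set [set x; z] | z in [set z in U | e x z]].
  move=> Ez; rewrite Ez (imset_f (fun z => [set x; z])) // inE Ee -?Ez // andbT.
  by apply: (subsetP fU); rewrite Ez !inE eqxx orbT.
move: xf; rewrite {1}Ef !inE => /orP[]/eqP Ex.
  by apply: (key b); rewrite Ex.
by apply: (key a); rewrite Ex setUC.
Qed.

(** A set strictly larger than the core is not dense, and a vertex witnessing this
    is outside of the core, so it can be deleted. The set E may have fewer edges
    than the graph of e whose core is considered: the edges of a graph are
    counted along the core of a larger one. *)
Lemma inside_peel d U j : core e d \subset U -> #|core e d| <= j <= #|U| ->
  exists U', [/\ core e d \subset U', #|U'| = j & inside U <= inside U' + d * (#|U| - j)].
Proof.
have [m] := ubnP (#|U| - j); elim: m U => // m IH U Hm cU /andP[cj jU].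
have [Ej|nj] := eqVneq #|U| j.
  by exists U; split=> //; rewrite leq_addr.
have ltU : #|core e d| < #|U| by rewrite ltn_neqAle in nj *; lia.
have [x [xU xc dx]] : exists x, [/\ x \in U, x \notin core e d & #|[set z in U | e x z]| <= d].
  have nD : ~~ dense e d U.
    apply/negP => /dense_sub_core /subset_leq_card; lia.
  move: nD; rewrite negb_forall_in => /exists_inP[x xU]; rewrite -leqNgt => dx.
  exists x; split=> //; apply/negP => xc.
  have := denseP _ _ _ (dense_core e d) x xc; apply/negP; rewrite -leqNgt.
  apply: leq_trans dx; apply/subset_leq_card/subsetP => z; rewrite !inE => /andP[zc ->].
  by rewrite andbT (subsetP cU).
have cD : #|U| = (#|U :\ x|).+1 by rewrite (cardsD1 x) xU.
have [|||U' [cU' sU' le]] := IH (U :\ x).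
- lia.
- by rewrite subsetD1 cU.
- by rewrite cj; lia.
exists U'; split=> //; apply: leq_trans (inside_delete x U) _.
apply: leq_trans (leq_add le dx) _; rewrite cD.
have -> : (#|U :\ x|).+1 - j = (#|U :\ x| - j).+1 by lia.
by rewrite mulnS; lia.
Qed.

Lemma edges_core d : #|E| <= inside (core e d) + d * (#|T| - #|core e d|).
Proof.
rewrite -inside_setT -cardsT.
have [||U [cU sU le]] := @inside_peel d setT #|core e d|;
  rewrite ?subsetT ?leqnn ?subset_leq_card //.
have /eqP Ec : core e d == U by rewrite eqEcard cU sU leqnn.
by rewrite {1}Ec.
Qed.

Lemma edges_empty_core d : core e d = set0 -> d <= #|T| ->
  #|E| <= 'C(d, 2) + d * (#|T| - d).
Proof.
rewrite -inside_setT -cardsT => c0 dT.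
have [||U [cU sU le]] := @inside_peel d setT d; rewrite ?subsetT ?c0 ?cards0 //.
by apply: leq_trans le _; rewrite leq_add2r -{1}sU inside_bin.
Qed.
End Count.

Section Bridge.
Variable n : nat.
Implicit Types G : sgraph n.

Lemma edge_card2 G : {in edges G, forall f : {set 'I_n}, #|f| = 2}.
Proof. by move=> f fG; apply/eqP; apply: (forall_inP (edges_card2 G)). Qed.

Lemma adj_sym G : symmetric (adj G).
Proof. by move=> x y; rewrite /adj setUC. Qed.

Lemma adj_irr G : irreflexive (adj G).
Proof.
by move=> x; apply/negP => /edge_card2; rewrite setUid cards1.
Qed.

Lemma adj_complete r (x y : 'I_r) : adj (complete_graph r) x y = (x != y).
Proof. by rewrite /adj inE cards2 andbT; case: (x != y). Qed.

Lemma adj_cycle l (x y : 'I_l) : adj (cycle_graph l) x y -> y = ordS x \/ x = ordS y.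
Proof.
rewrite /adj inE => /andP[c2 /existsP[i /eqP E]].
have xy : x != y by move: c2; rewrite cards2; case: (x != y).
have : x \in [set i; ordS i] by rewrite -E !inE eqxx.
have : y \in [set i; ordS i] by rewrite -E !inE eqxx orbT.
by rewrite !inE => /orP[]/eqP Ey /orP[]/eqP Ex; subst; rewrite ?eqxx // in xy *; auto.
Qed.

Lemma adj_cycle_ordS l (i : 'I_l) : 1 < l -> adj (cycle_graph l) i (ordS i).
Proof.
move=> l1; rewrite /adj inE; apply/andP; split; last by apply/existsP; exists i.
rewrite cards2; case: (i =P ordS i) => // /(congr1 (@nat_of_ord _)) /=.
have := ltn_ord i; rewrite leq_eqVlt => /orP[/eqP E|lt].
  by rewrite E modnn; lia.
by rewrite modn_small //; lia.
Qed.

Lemma clique_subgraph G r (D : {set 'I_n}) : r <= #|D| ->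
  {in D &, forall x y, x != y -> adj G x y} -> subgraph_of (complete_graph r) G.
Proof.
move=> rD cl; pose f (i : 'I_r) := enum_val (widen_ord rD i).
have fi : injective f.
  by move=> i j /enum_val_inj /(congr1 (@nat_of_ord _)) /= E; apply: val_inj.
exists f => // x y; rewrite adj_complete => xy.
by apply: cl; rewrite ?enum_valP // (inj_eq fi).
Qed.

Lemma cycle_subgraph G (c : seq 'I_n) : 0 < size c -> cycle (adj G) c -> uniq c ->
  subgraph_of (cycle_graph (size c)) G.
Proof.
case: c => // x0 c _ Cc Uc; set s := x0 :: c in Cc Uc *.
pose f (i : 'I_(size s)) := nth x0 s i.
have fS i : adj G (f i) (f (ordS i)).
  rewrite /f /=; move: (nat_of_ord i) (ltn_ord i) => j js.
  have : adj G (nth x0 s j) (nth x0 c j).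
    by have := next_cycle Cc (mem_nth x0 js); rewrite next_nth mem_nth // index_uniq.
  have := js; rewrite leq_eqVlt => /orP[/eqP E|lt].
    have Ej : j = size c by case: E.
    by rewrite E modnn Ej [nth x0 c _]nth_default.
  by rewrite modn_small.
exists f; first by move=> i j /eqP; rewrite nth_uniq // => /eqP /val_inj.
by move=> x y /adj_cycle[]->; rewrite // adj_sym.
Qed.

Lemma conn2_adj G : two_connected G -> forall v x y, x != v -> y != v ->
  exists q, [/\ path (adj G) x q, last x q = y & v \notin x :: q].
Proof.
case/andP=> _ /forallP /(_ [set _]) H v x y xv yv.
move: (H v); rewrite cards1 => /forall_inP /(_ x); rewrite !inE => /(_ xv).
move=> /forall_inP /(_ y); rewrite !inE => /(_ yv) /connectP[q Pq ->].
exists q; split=> //.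
  by apply: sub_path Pq => a b /and3P[].
have : all (predC1 v) q.
  elim: q x {xv} Pq => //= b q IH a /andP[/and3P[_ bv _] /IH->].
  by rewrite !inE in bv; rewrite bv.
by move=> /allP H'; rewrite inE negb_or eq_sym xv; apply/negP => /H' /=; rewrite eqxx.
Qed.
End Bridge.

(** * The upper bound *)

Section NewEdge.
Variables (T : finType) (e e' : rel T) (x y : T).
Hypothesis esym : symmetric e.
Hypothesis e'E : forall u v, e' u v -> e u v \/ [set u; v] = [set x; y].

(** Rotate the cycle so that a pair that is not an edge of e closes it. *)
Lemma broken_cycle (c : seq T) : ~~ cycle e c ->
  exists v p, perm_eq c (v :: p) /\ (cycle e' c -> cycle e' (v :: p)) /\ ~~ e (last v p) v.
Proof.
case: c => // a c nC.
have [[s1 [w [s2 [Ec nw]]]]|H] := pselect (exists s1 w s2,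
    rcons c a = s1 ++ w :: s2 /\ ~~ e (last a s1) w); last first.
  case/negP: nC; apply: path_splits => s1 w s2 E; apply/negPn/negP => nw.
  by apply: H; exists s1, w, s2.
case/lastP: s2 Ec => [|s2 b] Ec.
  exists a, c; split=> //; split=> //.
  by move: Ec; rewrite cats1 => /rcons_inj[Ec Ew]; rewrite Ec {2}Ew.
move: Ec; rewrite -rcons_cons -rcons_cat => /rcons_inj[Ec _].
have Er : rot (size (a :: s1)) (a :: c) = w :: s2 ++ a :: s1.
  by rewrite Ec (rot_size_cat (a :: s1)).
exists w, (s2 ++ a :: s1); rewrite last_cat /= nw; split; last split=> //.
  by rewrite Ec perm_sym; apply: (permEl (perm_catC (w :: s2) (a :: s1))).
by move=> C; rewrite -[X in is_true X]/(cycle e' (w :: s2 ++ a :: s1)) -Er rot_cycle.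
Qed.

(** A cycle created by adding the edge xy uses that edge once, having at least
    three vertices; the rest of it is a path from x to y. *)
Lemma new_edge_path c : ~~ cycle e c -> cycle e' c -> uniq c -> 2 < size c ->
  exists p, [/\ path e x p, uniq (x :: p), last x p = y & size (x :: p) = size c].
Proof.
move=> nC C' U sc; have [v [p [Pc [/(_ C') Cv nv]]]] := broken_cycle nC.
rewrite (perm_uniq Pc) in U; rewrite (perm_size Pc) in sc *.
move: (Cv) nv; rewrite /= rcons_path => /andP[Pp /e'E[->//|Eu]] _.
have Pe : path e v p.
  apply: path_splits => s1 w s2 Ep; move: Pp; rewrite Ep cat_path /= => /and3P[_ ew _].
  case: (e'E ew) => // E1; exfalso.
  have wp : w \in p by rewrite Ep mem_cat mem_head orbT.
  have wv : w != v by apply: contraTneq U => <-; rewrite /= wp.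
  have wu : w = last v p.
    have : w \in [set last v p; v] by rewrite Eu -E1 !inE eqxx orbT.
    by rewrite !inE (negPf wv) orbF => /eqP.
  have s20 : s2 = [::].
    apply: contraTeq U => s20; rewrite /= negb_and Ep cat_uniq /= !negb_and !negbK.
    suff -> : w \in s2 by rewrite !orbT.
    have ws : w = last w s2 by rewrite {1}wu Ep last_cat.
    by move: ws s20; case: (s2) => // b s ws _; rewrite {1}ws; apply: (mem_last b s).
  have s10 : s1 = [::].
    have : v \in [set last v s1; w] by rewrite E1 -Eu !inE eqxx orbT.
    rewrite !inE [v == w]eq_sym (negPf wv) orbF; case: (s1) Ep => //= b s Ep /eqP Ev.
    by move: U; rewrite Ep cons_uniq {1}Ev -cat_cons mem_cat mem_last.
  by move: sc; rewrite Ep s10 s20.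
have xy2 : (last v p == x) && (v == y) || (last v p == y) && (v == x).
  have uv : last v p != v.
    case: (p) U sc => //= b s /andP[+ _] _; apply: contraNneq => <-; exact: mem_last.
  have : last v p \in [set x; y] by rewrite -Eu !inE eqxx.
  have : v \in [set x; y] by rewrite -Eu !inE eqxx orbT.
  by rewrite !inE => /orP[]/eqP Ev /orP[]/eqP El; rewrite ?El ?Ev ?eqxx ?orbT //;
     case/eqP: uv; rewrite El Ev.
case/orP: xy2 => /andP[/eqP lu /eqP vx].
  exists (rev (belast v p)).
  have Ur : uniq (last v p :: rev (belast v p)) by rewrite rev_tail rev_uniq.
  rewrite -lu; split=> //; first exact: path_rev_tail.
    by rewrite last_rev_tail.
  by rewrite /= size_rev size_belast.
by exists p; rewrite -vx.
Qed.
End NewEdge.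

Section Upper.
Variables (n k : nat).
Implicit Types G : sgraph n.

Definition short_cycles G := forall c, cycle (adj G) c -> uniq c -> size c < k.

Lemma add_edge_card2 G (x y : 'I_n) : x != y ->
  [forall f in [set x; y] |: edges G, #|f| == 2].
Proof.
move=> xy; apply/forall_inP => f; rewrite in_setU1 => /orP[/eqP->|/edge_card2->//].
by rewrite cards2 xy.
Qed.

Lemma saturate G : 2 < k -> short_cycles G -> exists G', [/\ edges G \subset edges G',
  short_cycles G' & forall x y, x != y -> ~~ adj G' x y ->
    exists p, [/\ path (adj G') x p, uniq (x :: p), last x p = y & k <= size (x :: p)]].
Proof.
move=> k2 sG; pose P (H : sgraph n) := (edges G \subset edges H) && `[< short_cycles H >].
have PG : P G by rewrite /P subxx; apply/asboolP.
case: (arg_maxnP (fun H : sgraph n => #|edges H|) PG) => G' /andP[GG' /asboolP sG'] maxG'.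
exists G'; split=> // x y xy nxy.
pose G2 := SGraph (add_edge_card2 G' xy).
have nP : ~~ P G2.
  apply/negP => /maxG'; rewrite /= cardsU1 /adj in nxy *.
  by rewrite nxy leqNgt add1n ltnSn.
have {nP} [c [Cc Uc kc]] : exists c, [/\ cycle (adj G2) c, uniq c & k <= size c].
  apply/not_existsP => H; move/negP: nP; apply; apply/andP; split.
    by apply: subset_trans GG' _; apply: subsetUr.
  apply/asboolP => c Cc Uc; rewrite ltnNge; apply/negP => kc.
  by apply: (H c).
have e'E u v : adj G2 u v -> adj G' u v \/ [set u; v] = [set x; y].
  by rewrite /adj /= in_setU1 => /orP[/eqP|]; auto.
have nC : ~~ cycle (adj G') c by apply/negP => /sG'/(_ Uc); rewrite ltnNge kc.
have [|p [P1 P2 P3 P4]] := new_edge_path (@adj_sym n G') e'E nC Cc Uc.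
  exact: leq_trans kc.
by exists p; split=> //; rewrite P4.
Qed.

Lemma free_short_cycles G : 2 < k -> free (cycles_ge k) G -> short_cycles G.
Proof.
move=> k2 fG c Cc Uc; rewrite ltnNge; apply/negP => kc.
apply: (fG (C_ (size c))); last by apply: cycle_subgraph => //; lia.
by exists (size c) => //; split=> //; apply: leq_trans kc.
Qed.

Lemma free_cliques G r : free [set K_ r]%classic G ->
  forall D : {set 'I_n}, {in D &, forall x y, x != y -> adj G x y} -> #|D| < r.
Proof.
move=> fG D cl; rewrite ltnNge; apply/negP => rD.
exact: (fG (K_ r)) (clique_subgraph rD cl).
Qed.

(** The cores are those of the saturated graph G', which need not be K_r-free;
    inside the core, the edges are counted in G. *)
Theorem edge_bound G r t : 4 < k <= n -> k <= 2 * t + 2 -> t <= n -> two_connected G ->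
  short_cycles G ->
  (forall D : {set 'I_n}, {in D &, forall x y, x != y -> adj G x y} -> #|D| < r) ->
  #|edges G| <= 'C(t, 2) + t * (n - t) \/
  exists d, 2 <= d <= t /\
    #|edges G| + (k - d + 1 - r) <= 'C(k - d, 2) + d * (n - (k - d)).
Proof.
move=> /andP[k4 kn] kt tn G2 sG noK.
have [|G' [GG' sG' satG']] := @saturate G _ sG; first by lia.
have conn' v x y : x != v -> y != v ->
    exists q, [/\ path (adj G') x q, last x q = y & v \notin x :: q].
  move=> xv yv; have [q [Pq lq vq]] := conn2_adj G2 xv yv; exists q; split=> //.
  by apply: sub_path Pq => a b; apply: (subsetP GG').
have Ee x y : [set x; y] \in edges G -> adj G' x y by apply: (subsetP GG').
have [c0|c0] := eqVneq (core (adj G') t) set0.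
  left; have := edges_empty_core (@edge_card2 n G) Ee c0.
  by rewrite card_ord => /(_ tn).
right; have [||d [dt sd Ed]] :=
  core_structure (@adj_sym n G') (@adj_irr n G') conn' _ sG' satG' kt _ c0.
- by rewrite card_ord; lia.
- by rewrite card_ord.
exists d; split=> //.
have := edges_core (@edge_card2 n G) Ee d.
have := @inside_clique_free _ _ (@edge_card2 n G) r (core (adj G') t) noK.
rewrite Ed card_ord; have -> : #|core (adj G') t| = k - d by lia.
clear; lia.
Qed.
End Upper.

(** * The extremal graphs *)

Section NatGraph.
Variables (n : nat) (h : rel nat).
Hypothesis hsym : symmetric h.
Hypothesis hirr : irreflexive h.

Definition nat_graph : sgraph n :=
  SGraph (filter_card2 (n := n)
    (fun f => [exists x : 'I_n, [exists y : 'I_n, (f == [set x; y]) && h x y]])).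

Lemma adj_nat_graph (x y : 'I_n) : adj nat_graph x y = h x y.
Proof.
rewrite /adj inE; apply/andP/idP => [[]|hxy].
  rewrite cards2; case: (x =P y) => // /eqP xy _ /existsP[u /existsP[v /andP[/eqP E huv]]].
  have : x \in [set u; v] by rewrite -E !inE eqxx.
  have : y \in [set u; v] by rewrite -E !inE eqxx orbT.
  rewrite !inE => /orP[]/eqP Ey /orP[]/eqP Ex; rewrite Ex Ey // ?[h v u]hsym //.
    by rewrite Ex Ey eqxx in xy.
  by rewrite Ex Ey eqxx in xy.
split; last by apply/existsP; exists x; apply/existsP; exists y; rewrite eqxx hxy.
by rewrite cards2; case: (x =P y) hxy => // ->; rewrite hirr.
Qed.

Lemma nat_graph_edges : \sum_(y < n) \sum_(x < y) h x y <= #|edges nat_graph|.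
Proof.
pose Q := [set p : 'I_n * 'I_n | (p.1 < p.2) && h p.1 p.2].
pose F (p : 'I_n * 'I_n) := [set p.1; p.2].
have Finj : {in Q &, injective F}.
  move=> [x y] [u v]; rewrite !inE /= => /andP[xy _] /andP[uv _] E.
  rewrite /F /= in E.
  have : x \in [set u; v] by rewrite -E !inE eqxx.
  have : y \in [set u; v] by rewrite -E !inE eqxx orbT.
  by rewrite !inE => /orP[]/eqP Ey /orP[]/eqP Ex; subst; move: xy uv; rewrite ?ltnn //; lia.
have FQ : F @: Q \subset edges nat_graph.
  apply/subsetP => f /imsetP[[x y]]; rewrite inE /= => /andP[_ hxy] ->.
  by have := adj_nat_graph x y; rewrite hxy.
apply: leq_trans (subset_leq_card FQ); rewrite (card_in_imset Finj).
have -> : #|Q| = \sum_(x < n) \sum_(y < n) (if (x, y) \in Q then 1 else 0).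
  by rewrite pair_bigA -sum1_card big_mkcond; apply: eq_bigr => -[].
rewrite exchange_big /=.
apply: leq_sum => y _.
rewrite (big_ord_widen n (fun x => h x y : nat) (ltnW (ltn_ord y))) big_mkcond /=.
apply: leq_sum => x _; rewrite inE /=.
by case: (x < y); case: (h x y).
Qed.
End NatGraph.

Lemma sum_interval lo hi s : \sum_(i < s) (lo <= i < hi) <= hi - lo.
Proof.
suff : \sum_(i < s) (lo <= i < hi) <= minn s hi - lo by lia.
elim: s => [|s IH]; first by rewrite big_ord0.
rewrite big_ord_recr /=; apply: leq_trans (leq_add IH (leqnn _)) _.
by case: (leqP lo s) => /=; case: (ltnP s hi) => /=; lia.
Qed.

Lemma sum_shift_eq j m y : \sum_(x < j) (x + m == y) <= 1.
Proof.
suff : \sum_(x < j) (x + m == y) <= (y < j + m) by case: (y < j + m); lia.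
elim: j => [|j IH]; first by rewrite big_ord0.
rewrite big_ord_recr /=; apply: leq_trans (leq_add IH (leqnn _)) _.
by case: (ltnP y (j + m)); case: eqP; case: (ltnP y (j.+1 + m)) => //=; lia.
Qed.

Lemma card_bounded_fiber l n (f : 'I_l -> 'I_n) b : injective f ->
  #|[set i | f i < b]| <= b.
Proof.
move=> fi; case: b => [|b].
  by rewrite (_ : [set i | _] = set0) ?cards0 //; apply/setP => i; rewrite !inE.
have inj : {in [set i | f i < b.+1] &, injective (fun i => inord (f i) : 'I_b.+1)}.
  move=> i j; rewrite !inE => fb1 fb2 /(congr1 (@nat_of_ord _)); rewrite !inordK // => E.
  by apply: fi; apply: val_inj.
by rewrite -(card_in_imset inj); apply: leq_trans (max_card _) _; rewrite card_ord.
Qed.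

Section Extremal.
Variables (n s a m : nat).
Hypothesis ams : a + 2 * m <= s.
Hypothesis sn : s <= n.

(** Vertices are split as [0, a), [a, s) and [s, n). On [0, s), two distinct
    vertices have equal colours when they are x and x + m with a <= x < a + m;
    these pairs form the missing matching. *)
Definition colour x := if x < a + m then x else x - m.

Definition extremal_rel x y := (x != y) &&
  [|| x < a, y < a | [&& x < s, y < s & colour x != colour y]].

Lemma colour_inj x y : x < y < s -> colour x = colour y -> x + m = y /\ a + m <= y < a + 2 * m.
Proof.
by rewrite /colour; case: (ltnP x (a + m)); case: (ltnP y (a + m)); lia.
Qed.

Lemma colour_bound x : x < s -> colour x < s - m.
Proof. by rewrite /colour; case: (ltnP x (a + m)); lia. Qed.

Lemma extremal_rel_colour x y : x < s -> y < s -> extremal_rel x y -> colour x != colour y.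
Proof.
rewrite /extremal_rel /colour; case: (ltnP x (a + m)); case: (ltnP y (a + m)); lia.
Qed.

Lemma extremal_rel_sym : symmetric extremal_rel.
Proof.
by move=> x y; rewrite /extremal_rel eq_sym [colour y == _]eq_sym orbCA [in RHS]andbCA.
Qed.

Lemma extremal_rel_irr : irreflexive extremal_rel.
Proof. by move=> x; rewrite /extremal_rel eqxx. Qed.

Definition extremal_graph := nat_graph n extremal_rel.

Lemma adj_extremal (x y : 'I_n) : adj extremal_graph x y = extremal_rel x y.
Proof. exact: adj_nat_graph extremal_rel_sym extremal_rel_irr x y. Qed.

(** Each vertex y is charged with the edges to smaller vertices: y of them, or y - 1
    if it is the larger end of a missing pair, when y < s, and a when s <= y. *)
Lemma extremal_graph_edges : 'C(s, 2) + a * (n - s) <= #|edges extremal_graph| + m.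
Proof.
have deg y : y < s -> y <= \sum_(x < y) extremal_rel x y + (a + m <= y < a + 2 * m).
  move=> ys; have key x : x < y -> ~~ extremal_rel x y -> x + m = y /\ a + m <= y < a + 2 * m.
    move=> xy; rewrite /extremal_rel ys (ltn_trans xy ys) (ltn_eqF xy) /= !negb_or negbK.
    by case/and3P=> _ _ /eqP; apply: colour_inj; rewrite xy.
  case: (boolP (a + m <= y < a + 2 * m)) => yI.
    apply: leq_trans (leq_add (leqnn _) (sum_shift_eq y m y)).
    rewrite -big_split /= -[leqLHS]card_ord -sum1_card; apply: leq_sum => x _.
    by have := key x (ltn_ord x); case: (extremal_rel x y) => //= /(_ isT)[->]; rewrite eqxx.
  rewrite addn0 -[leqLHS]card_ord -sum1_card; apply: leq_sum => x _.
  have := key x (ltn_ord x); case: (extremal_rel x y) => //= /(_ isT)[_].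
  by rewrite (negPf yI).
have deg2 y : s <= y -> a <= \sum_(x < y) extremal_rel x y.
  move=> sy; have ay : a <= y by lia.
  rewrite -[leqLHS]card_ord -sum1_card (big_ord_widen y (fun=> 1) ay) big_mkcond /=.
  apply: leq_sum => x _; case: ifP => // xa.
  by rewrite /extremal_rel xa (ltn_eqF (ltn_ord x)).
apply: leq_trans (leq_add (nat_graph_edges n extremal_rel_sym extremal_rel_irr) (leqnn m)).
rewrite -(big_mkord xpredT (fun y => \sum_(x < y) extremal_rel x y)).
rewrite (big_cat_nat _ (n := s)) //= addnAC; apply: leq_add; last first.
  rewrite mulnC -sum_nat_const_nat !big_nat; apply: leq_sum => y /andP[sy _]; exact: deg2.
have mI : \sum_(y < s) (a + m <= y < a + 2 * m) <= m.
  by apply: leq_trans (sum_interval _ _ _) _; lia.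
apply: leq_trans (leq_add (leqnn _) mI).
rewrite -bin2_sum !big_mkord -big_split; apply: leq_sum => y _; exact: deg.
Qed.

(** A clique with a vertex in [s, n) has all others in [0, a); a clique inside
    [0, s) has at most one vertex of each of the s - m colours. *)
Lemma extremal_graph_clique_free r : a + 1 < r -> s - m < r ->
  ~ subgraph_of (complete_graph r) extremal_graph.
Proof.
move=> ar sr [f fi hf].
have ff i j : i != j -> extremal_rel (f i) (f j).
  by rewrite -adj_extremal -adj_complete; apply: hf.
case: (pickP (fun i => s <= f i)) => [i0 si|fs].
  have : #|[set~ i0]| <= a.
    apply: leq_trans (card_bounded_fiber a fi); apply/subset_leq_card/subsetP => j.
    rewrite !inE => /ff; rewrite /extremal_rel; lia.
  by rewrite cardsC1 card_ord; lia.
have sm0 : 0 < s - m.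
  by have := fs (Ordinal (ltnW (leq_ltn_trans (leq_addl a 1) ar))); lia.
pose c i : 'I_(s - m).-1.+1 := inord (colour (f i)).
suff ci : injective c by have := leq_card c ci; rewrite !card_ord; lia.
have fsi i : f i < s by rewrite ltnNge fs.
have cb i : colour (f i) < (s - m).-1.+1 by rewrite prednK // colour_bound.
move=> i j /(congr1 (@nat_of_ord _)); rewrite !inordK // => E.
apply/eqP/negPn/negP => /ff /(extremal_rel_colour (fsi i) (fsi j)).
by rewrite E eqxx.
Qed.

(** On the cycle, let S be the positions in [s, n) and C those in [0, a). Since at
    most s positions are outside of S, there are at least a in S. The successor
    and the predecessor of a position in S are in C, which has at most a elements.
    So the successors of C are exactly S, hence S and C exhaust the cycle and its
    length is at most 2a. *)
Lemma extremal_graph_short_cycles l : 2 < l -> 0 < a -> s + a <= l -> 2 * a < l ->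
  ~ subgraph_of (cycle_graph l) extremal_graph.
Proof.
move=> l2 a0 sal al [f fi hf].
have step i : extremal_rel (f i) (f (ordS i)).
  by rewrite -adj_extremal; apply: hf; apply: adj_cycle_ordS; lia.
pose S := [set i | s <= f i]; pose C := [set i | f i < a].
have SC i : i \in S -> ordS i \in C.
  by rewrite !inE; have := step i; rewrite /extremal_rel; lia.
have CS i : ordS i \in S -> i \in C.
  by rewrite !inE; have := step i; rewrite /extremal_rel; lia.
have cC : #|C| <= a by apply: card_bounded_fiber.
have cS : a <= #|S|.
  have := cardsC S; rewrite card_ord.
  have -> : ~: S = [set i | f i < s] by apply/setP => i; rewrite !inE ltnNge.
  have := card_bounded_fiber s fi; lia.
pose P := [set i | ordS i \in S].
have cP : #|P| = #|S|.
  rewrite -(card_imset _ (@ordS_inj l)); apply: eq_card => i; apply/imsetP/idP => [[j]|iS].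
    by rewrite inE => jS ->.
  exists (ord_pred i); last by rewrite ord_predK.
  by rewrite in_set ord_predK.
have CP : C = P.
  apply/esym/eqP; rewrite eqEcard cP (leq_trans cC cS) andbT.
  by apply/subsetP => i; rewrite inE; apply: CS.
have cl i : i \in S :|: C -> ordS i \in S :|: C.
  rewrite !in_setU => /orP[/SC->|]; first by rewrite orbT.
  by rewrite {1}CP inE => ->.
have [i0 iS] : exists i, i \in S by apply/card_gt0P; lia.
have all_in d i : nat_of_ord i = (i0 + d) %% l -> i \in S :|: C.
  elim: d i => [|d IH] i E.
    suff -> : i = i0 by rewrite inE iS.
    by apply: val_inj; rewrite /= E addn0 modn_small.
  have -> : i = ordS (ord_pred i) by rewrite ord_predK.
  apply: cl; apply: IH.
  have l0 : 0 < l by lia.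
  have : ord_pred i = Ordinal (ltn_pmod (i0 + d) l0).
    apply: (@ordS_inj l); rewrite ord_predK; apply: val_inj => /=.
    by rewrite E addnS -[in RHS]addn1 modnDml addn1.
  by move=> ->.
have cSC : #|S :|: C| = l.
  rewrite -[RHS]card_ord -cardsT; congr #|pred_of_set _|; apply/setP => i; rewrite in_setT.
  apply: (all_in (i + (l - i0))); have := ltn_ord i0 => i0l.
  by rewrite addnCA subnKC 1?ltnW // modnDr modn_small.
have : #|S :|: C| <= #|S| + #|C| by apply: leq_card_setU.
rewrite cSC leqNgt => /negP; apply.
have leS : #|S| <= a by rewrite -cP -CP.
by apply: leq_ltn_trans (leq_add leS cC) _; rewrite addnn -mul2n.
Qed.

Lemma extremal_graph_2conn : 1 < a -> 2 < n -> two_connected extremal_graph.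
Proof.
move=> a1 n2; rewrite /two_connected n2; apply/forall_inP => X X1.
have [c [ca cX]] : exists c : 'I_n, c < a /\ c \notin X.
  have n0 : 0 < n by lia.
  have n1 : 1 < n by lia.
  have [zX|zX] := boolP (Ordinal n0 \in X); last by exists (Ordinal n0); split=> //=; lia.
  exists (Ordinal n1); split=> //; apply/negP => oX.
  have : [set Ordinal n0; Ordinal n1] \subset X by apply/subsetP => z; rewrite !inE => /orP[]/eqP->.
  by move/subset_leq_card; rewrite cards2 -val_eqE leqNgt X1.
have toc x : x \notin X -> x != c -> adj extremal_graph x c.
  by move=> xX xc; rewrite adj_extremal /extremal_rel ca orbT xc.
apply/forall_inP => x; rewrite inE => xX; apply/forall_inP => y; rewrite inE => yX.
apply: (@connect_trans _ _ c).
  have [->|xc] := eqVneq x c; first exact: connect0.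
  by apply: connect1; rewrite !inE xX cX toc.
have [->|yc] := eqVneq y c; first exact: connect0.
by apply: connect1; rewrite !inE yX cX adj_sym toc.
Qed.
End Extremal.

(** * The extremal number *)

Lemma bin2S s : 'C(s.+1, 2) = 'C(s, 2) + s.
Proof. by rewrite binS bin1. Qed.

Lemma ex_clique_le s r : 0 < r -> ex s [set K_ r]%classic <= 'C(s, 2) - (s + 1 - r).
Proof.
move=> r0; apply/bigmax_leqP => G /asboolP fG.
have := @inside_clique_free _ _ (@edge_card2 s G) r setT (free_cliques fG).
by rewrite inside_setT cardsT card_ord; lia.
Qed.

Lemma ex_clique_ge s r a : a + 1 < r -> a + 2 * (s + 1 - r) <= s ->
  'C(s, 2) - (s + 1 - r) <= ex s [set K_ r]%classic.
Proof.
move=> ar as2.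
have fG : free [set K_ r]%classic (extremal_graph s s a (s + 1 - r)).
  by move=> _ -> /=; apply: extremal_graph_clique_free => //; lia.
apply: leq_trans (_ : #|edges (extremal_graph s s a (s + 1 - r))| <= _); last first.
  by apply: (leq_bigmax_cond (F := fun G : sgraph s => #|edges G|)); apply/asboolP.
by have := extremal_graph_edges as2 (leqnn s); lia.
Qed.

Lemma g_le_ex_2conn r n a k : 4 < k <= n -> 1 < a -> 2 * a < k -> a + 1 < r ->
  a + 2 * (k - a + 1 - r) <= k - a ->
  g r n a k <= ex_2conn n ([set K_ r] `|` cycles_ge k)%classic.
Proof.
move=> /andP[k4 kn] a1 ak ar as2; set s := k - a in as2 *; set m := s + 1 - r in as2 *.
have sn : s <= n by lia.
apply: leq_trans (_ : #|edges (extremal_graph n s a m)| <= _); last first.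
  apply: (leq_bigmax_cond (F := fun G : sgraph n => #|edges G|)); apply/asboolP.
  split; first by apply: extremal_graph_2conn; lia.
  move=> F [->|[l [l3 kl] <-]] /=; first by apply: extremal_graph_clique_free; lia.
  by apply: extremal_graph_short_cycles => //; lia.
have mC : m <= 'C(s, 2).
  have [s' Es] : exists s', s = s'.+1 by exists s.-1; lia.
  by rewrite Es bin2S; lia.
have := extremal_graph_edges as2 sn; have r0 : 0 < r by lia.
have := ex_clique_le s r0; rewrite /g -/s -/m.
have -> : n - k + a = n - s by lia.
by rewrite [(n - s) * a]mulnC; lia.
Qed.

(** Once a convex function has exceeded its first value, it increases; so each value
    is at most the first one or at most the next one. *)
Lemma convex_max (psi : nat -> nat) lo hi d :
  (forall a, lo <= a -> a + 2 <= hi -> 2 * psi a.+1 <= psi a + psi a.+2) ->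
  lo <= d <= hi -> psi d <= maxn (psi lo) (psi hi).
Proof.
move=> conv.
have up h : lo <= h < hi -> psi h <= psi lo \/ psi h <= psi h.+1.
  elim: h => [|h IH] /andP[lh hh]; first by left; rewrite (_ : lo = 0) //; lia.
  have [El|ne] := eqVneq lo h.+1; first by left; rewrite El.
  have := conv h; case: IH => [|H|H]; by lia.
have [m] := ubnP (hi - d); elim: m d => // m IH d Hm /andP[ld dh].
have [->|ne] := eqVneq d hi; first by rewrite leq_maxr.
case: (up d) => [|H|H]; first by lia.
  by apply: leq_trans H _; rewrite leq_maxl.
by apply: leq_trans H _; apply: IH; lia.
Qed.

Theorem theorem7 (k r n : nat) (hnk : k <= n) (hk : 5 <= k)
  (hr : (k - 1) %/ 2 + 2 <= r) (hrk : r < k) :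
  ex_2conn n ([set K_ r] `|` cycles_ge k)%classic =
  maxn (g r n 2 k) (g r n ((k - 1) %/ 2) k).
Proof.
set t := (k - 1) %/ 2 in hr *.
have [t1 t2] : 2 * t + 1 <= k /\ k <= 2 * t + 2 by rewrite /t; lia.
clearbody t; apply/eqP; rewrite eqn_leq; apply/andP; split; last first.
  by rewrite geq_max; apply/andP; split; apply: g_le_ex_2conn; lia.
(* psi a is the value of g r n a k wherever the matching fits; see ex_clique_ge. *)
pose psi a := (n - (k - a)) * a + ('C(k - a, 2) - (k - a + 1 - r)).
have psi_g a : a <= k -> a + 1 < r -> a + 2 * (k - a + 1 - r) <= k - a -> psi a = g r n a k.
  move=> ak ar as2; rewrite /g /psi; congr (_ * _ + _); first by lia.
  by apply/eqP; rewrite eqn_leq (ex_clique_ge ar as2) ex_clique_le //; lia.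
have g2 : psi 2 = g r n 2 k by apply: psi_g; lia.
have gt : psi t = g r n t k by apply: psi_g; lia.
(* The second difference of the quadratic part is 3; that of the truncated term
   is at most 1. *)
have conv a : 2 <= a -> a + 2 <= t -> 2 * psi a.+1 <= psi a + psi a.+2.
  move=> a2 at2; rewrite /psi.
  have [s Es] : exists s, k - a = s.+2 by exists (k - a - 2); lia.
  have -> : k - a.+1 = s.+1 by lia.
  have -> : k - a.+2 = s by lia.
  rewrite Es !bin2S.
  have [b Eb] : exists b, n - s.+2 = b by exists (n - s.+2).
  have -> : n - s.+1 = b.+1 by lia.
  have -> : n - s = b.+2 by lia.
  rewrite Eb; have s3 : 3 <= s by lia.
  have : s <= 'C(s, 2).
    have [s' Es'] : exists s', s = s'.+2 by exists (s - 2); lia.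
    by rewrite Es' !bin2S; lia.
  nia.
rewrite -g2 -gt.
apply/bigmax_leqP => G /asboolP[G2 fG].
have sG : short_cycles k G.
  by apply: free_short_cycles; [lia|move=> F cF; apply: fG; right].
have noK := @free_cliques n G r (fun F kF => fG F (or_introl kF)).
case: (@edge_bound n k G r t _ t2 _ G2 sG noK); try by lia.
  (* Empty t-core: equality if k - t = t + 1, and otherwise the single edge to spare
     pays for the at most one missing pair. *)
  move=> H; apply: leq_trans (leq_maxr _ _); apply: leq_trans H _; rewrite /psi.
  have [Ek|Ek] : k - t = t.+1 \/ k - t = t.+2 by lia.
    rewrite Ek bin2S; have -> : n - t = (n - t.+1).+1 by lia.
    have -> : t.+1 + 1 - r = 0 by lia.
    by rewrite mulnS mulnC; lia.
  rewrite Ek !bin2S; have -> : n - t = (n - t.+2).+2 by lia.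
  by rewrite !mulnS mulnC; lia.
case=> d [dt H]; apply: leq_trans (convex_max conv dt).
by rewrite /psi mulnC; lia.
Qed.
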